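(* Let the digraphs and weight matrices satisfy Assumption G, and let the constraint set $\Omega$ and the costs $f_{i,t}$ satisfy Assumption C (both stated in the context). Let $\{x_{i,t}\}_{t\ge0}$ be generated by Algorithm 2 (described in the context) with step size $\alpha_t=\frac{1}{\sqrt{t+1}}$. Then, for a given time horizon $T\in\mathbb{N}_{+}$ and every node $j\in\mathcal{V}$, the dynamic regret $\tilde{\mathcal{R}}_j^d(T)=\sum_{t=0}^{T}F_t(x_{j,t})-\sum_{t=0}^{T}F_t(x_t^\star)$ satisfies $$\tilde{\mathcal{R}}_j^d(T)\le\mathcal{K}_3+\mathcal{K}_4\sqrt{T},$$ where $$\mathcal{K}_3=\frac{(2\theta\lambda+\theta+2)nCG}{1-\lambda}\sum_{i=1}^n\Vert x_{i,0}\Vert+\frac{2n^2\theta CGR}{\lambda(1-\lambda)},$$ $$\mathcal{K}_4=\frac{2(3\theta+2)n^2\theta CG^2}{1-\lambda}+n\theta^2G^2+2nR\,\mathcal{C}_T+2nR^2.$$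
   Context: Network. There are $n$ nodes $\mathcal{V}=\{1,\dots,n\}$ and digraphs $\mathcal{G}_t=(\mathcal{V},\mathcal{E}_t)$, $t\ge 0$; $(i,j)\in\mathcal{E}_t$ means node $j$ receives information from node $i$ at time $t$. Each node is its own in- and out-neighbor, i.e. $(i,i)\in\mathcal{E}_t$. The weight matrix $\mathcal{A}_t=[a_{ij,t}]\in\mathbb{R}^{n\times n}$ has $a_{ij,t}>0$ if $(j,i)\in\mathcal{E}_t$ and $a_{ij,t}=0$ otherwise. Assumption G: (a) there is $\gamma\in(0,1)$ that lower bounds all nonzero weights $a_{ij,t}$; (b) each $\mathcal{A}_t$ is column-stochastic, $\mathcal{A}_t^{\mathrm T}\mathbf{1}_n=\mathbf{1}_n$; (c) there is a positive integer $B$ such that for every $t$ the union digraph $(\mathcal{V},\bigcup_{l=0}^{B-1}\mathcal{E}_{t+l})$ is strongly connected. Costs. Each $f_{i,t}:\mathbb{R}^m\to\mathbb{R}$ is a convex function, $F_t(x)=\sum_{i=1}^n f_{i,t}(x)$, and $x_t^\star\in\arg\min_{x\in\Omega}F_t(x)$. The path variation is $\mathcal{C}_T=\sum_{t=0}^{T}\Vert x_{t+1}^\star-x_t^\star\Vert$. Assumption C: (a) $\Omega\subseteq\mathbb{R}^m$ is nonempty, convex and closed, and there are $r,R>0$ with $r\mathbb{B}^m\subseteq\Omega\subseteq R\mathbb{B}^m$, where $\mathbb{B}^m$ is the closed Euclidean unit ball; (b) there is $G>0$ such that $\Vert g\Vert\le G$ for all $g\in\partial f_{i,t}(x)$, $x\in\Omega$,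 all $i$ and $t$. Algorithm 2. Initialize with $x_{i,0}\in\Omega$ and $\phi_{i,0}=1$. For $t=0,1,2,\dots$ and each $i$: $$\phi_{i,t+1}=\sum_{j=1}^n a_{ij,t}\phi_{j,t},\qquad b_{ij,t}=\frac{a_{ij,t}\phi_{j,t}}{\phi_{i,t+1}},$$ $$x_{i,t+1}=\mathcal{P}_{\Omega}\Big(\sum_{j=1}^n b_{ij,t}x_{j,t}-\frac{\alpha_t}{\phi_{i,t+1}}g_{i,t}(x_{i,t})\Big),$$ where $\mathcal{P}_\Omega$ is Euclidean projection onto $\Omega$ and $g_{i,t}(x_{i,t})\in\partial f_{i,t}(x_{i,t})$ is a subgradient. Constants $C,\lambda,\theta$. Let $\mathcal{B}_t=[b_{ij,t}]$ (row-stochastic), and $\mathcal{B}(s:t)=\mathcal{B}_{s-1}\cdots\mathcal{B}_t$ for $s\ge t$, with $\mathcal{B}(t:t)=I$ and entries $b_{ij}(s:t)$. Under Assumption G it is known that there exist vectors $\pi_t=[\pi_{1,t},\dots,\pi_{n,t}]^{\mathrm T}$, $t\ge0$, with positive entries, $\mathbf{1}_n^{\mathrm T}\pi_t=1$ and $\pi_t^{\mathrm T}=\pi_{t+1}^{\mathrm T}\mathcal{B}_t$, and constants $C>0$, $\lambda\in(0,1)$ with $|b_{ij}(s:t)-\pi_{j,t}|\le C\lambda^{s-t}$ for all $i,j$ and $s\ge t\ge0$; and a constant $\theta>0$ with $\phi_{i,t}\ge\theta^{-1}$ for all $i$ and $t\ge 0$. The symbols $C,\lambda,\theta$ denote such constants.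 *)

(* Defs.v *)
From mathcomp Require Import all_boot all_order all_algebra.
From mathcomp Require Import all_classical all_reals all_analysis.

Set Implicit Arguments.
Unset Strict Implicit.
Unset Printing Implicit Defensive.

Import Order.TTheory GRing.Theory Num.Theory.
Import numFieldNormedType.Exports.

Local Open Scope classical_set_scope.
Local Open Scope ring_scope.

(* The library norm on matrices is the sup norm, hence the Euclidean inner
   product and norm below.  Both norms induce the same topology, so the library
   predicate [closed] on ['rV_m] is the intended one. *)
Definition edot (R : realType) (m : nat) (u v : 'rV[R]_m) : R :=
  \sum_(k < m) u 0 k * v 0 k.

Definition enorm (R : realType) (m : nat) (u : 'rV[R]_m) : R :=
  Num.sqrt (edot u u).

Definition eball (R : realType) (m : nat) (r : R) : set 'rV[R]_m :=
  [set u | enorm u <= r].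

Definition subdifferential (R : realType) (m : nat) (f : 'rV[R]_m -> R)
    (x : 'rV[R]_m) : set 'rV[R]_m :=
  [set g | forall y, f x + edot g (y - x) <= f y].

Definition argmin (R : realType) (m : nat) (Omega : set 'rV[R]_m)
    (F : 'rV[R]_m -> R) : set 'rV[R]_m :=
  [set x | Omega x /\ forall y, Omega y -> F x <= F y].

(* [is_proj Omega y p] reads p = P_Omega(y); for Omega nonempty, closed and
   convex there is exactly one such p. *)
Definition is_proj (R : realType) (m : nat) (Omega : set 'rV[R]_m)
    (y p : 'rV[R]_m) : Prop :=
  argmin Omega (fun z => enorm (y - z)) p.

(* [E t i j] means that node j receives information from node i at time t;
   note the transposition in [a_ij,t > 0 iff (j,i) is an edge]. *)
Definition weighted_digraphs (R : realType) (n : nat)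
    (E : nat -> rel 'I_n) (A : nat -> 'M[R]_n) : Prop :=
  (forall t i, E t i i) /\
  (forall t i j, (E t j i -> 0 < A t i j) /\ (~~ E t j i -> A t i j = 0)).

Definition strongly_connected (n : nat) (e : rel 'I_n) : Prop :=
  forall i j, connect e i j.

Definition union_digraph (n : nat) (E : nat -> rel 'I_n) (B t : nat) :
    rel 'I_n :=
  fun i j => [exists l : 'I_B, E (t + l)%N i j].

Definition assumption_G (R : realType) (n : nat)
    (E : nat -> rel 'I_n) (A : nat -> 'M[R]_n) : Prop :=
  [/\ exists gamma : R, [/\ 0 < gamma, gamma < 1 &
        forall t i j, A t i j != 0 -> gamma <= A t i j],
      forall t, (A t)^T *m const_mx 1 = const_mx 1 :> 'cV[R]_n
    & exists B : nat, (0 < B)%N /\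
        forall t, strongly_connected (union_digraph E B t)].

Definition assumption_C (R : realType) (n m : nat) (Omega : set 'rV[R]_m)
    (f : 'I_n -> nat -> 'rV[R]_m -> R) (rad G : R) : Prop :=
  [/\ [/\ Omega !=set0, convex_set Omega & closed Omega],
      exists r : R, [/\ 0 < r, 0 < rad,
        @eball R m r `<=` Omega & Omega `<=` @eball R m rad]
    & 0 < G /\ forall i t x g, Omega x -> subdifferential (f i t) x g ->
        enorm g <= G].

Fixpoint phi (R : realType) (n : nat) (A : nat -> 'M[R]_n) (t : nat) :
    'cV[R]_n :=
  if t is s.+1 then A s *m phi A s else const_mx 1.

Definition Bmx (R : realType) (n : nat) (A : nat -> 'M[R]_n) (t : nat) :
    'M[R]_n :=
  \matrix_(i, j) (A t i j * phi A t j 0 / phi A t.+1 i 0).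

(* [Bprod A s t] is B(s:t) = B_(s-1) ... B_t; it is only meaningful for
   t <= s. *)
Fixpoint Bprod (R : realType) (n : nat) (A : nat -> 'M[R]_n) (s t : nat) :
    'M[R]_n :=
  if s is s'.+1 then
    if (t <= s')%N then Bmx A s' *m Bprod A s' t else 1%:M
  else 1%:M.

Definition network_constants (R : realType) (n : nat) (A : nat -> 'M[R]_n)
    (C lambda theta : R) : Prop :=
  [/\ [/\ 0 < C, 0 < lambda, lambda < 1 & 0 < theta],
      exists p : nat -> 'cV[R]_n,
        [/\ forall t i, 0 < p t i 0,
            forall t, \sum_(i < n) p t i 0 = 1,
            forall t, (p t)^T = (p t.+1)^T *m Bmx A t
          & forall i j s t, (t <= s)%N ->
              `|Bprod A s t i j - p t j 0| <= C * lambda ^+ (s - t)]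
    & forall i t, theta^-1 <= phi A t i 0].

Definition algorithm2 (R : realType) (n m : nat) (A : nat -> 'M[R]_n)
    (Omega : set 'rV[R]_m) (f : 'I_n -> nat -> 'rV[R]_m -> R)
    (alpha : nat -> R) (x : 'I_n -> nat -> 'rV[R]_m) : Prop :=
  (forall i, Omega (x i 0%N)) /\
  exists g : 'I_n -> nat -> 'rV[R]_m, forall i t,
    subdifferential (f i t) (x i t) (g i t) /\
    is_proj Omega
      (\sum_(j < n) Bmx A t i j *: x j t
         - (alpha t / phi A t.+1 i 0) *: g i t)
      (x i t.+1).

Definition total_cost (R : realType) (n m : nat)
    (f : 'I_n -> nat -> 'rV[R]_m -> R) (t : nat) (x : 'rV[R]_m) : R :=
  \sum_(i < n) f i t x.

Definition path_variation (R : realType) (m : nat)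
    (xstar : nat -> 'rV[R]_m) (T : nat) : R :=
  \sum_(0 <= t < T.+1) enorm (xstar t.+1 - xstar t).

Definition dynamic_regret (R : realType) (n m : nat)
    (f : 'I_n -> nat -> 'rV[R]_m -> R) (x : 'I_n -> nat -> 'rV[R]_m)
    (xstar : nat -> 'rV[R]_m) (j : 'I_n) (T : nat) : R :=
  \sum_(0 <= t < T.+1) total_cost f t (x j t)
    - \sum_(0 <= t < T.+1) total_cost f t (xstar t).

Definition K3 (R : realType) (n m : nat) (C lambda theta G rad : R)
    (x : 'I_n -> nat -> 'rV[R]_m) : R :=
  (2 * theta * lambda + theta + 2) * n%:R * C * G / (1 - lambda)
    * (\sum_(i < n) enorm (x i 0%N))
  + 2 * n%:R ^+ 2 * theta * C * G * rad / (lambda * (1 - lambda)).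

Definition K4 (R : realType) (n m : nat) (C lambda theta G rad : R)
    (xstar : nat -> 'rV[R]_m) (T : nat) : R :=
  2 * (3 * theta + 2) * n%:R ^+ 2 * theta * C * G ^+ 2 / (1 - lambda)
  + n%:R * theta ^+ 2 * G ^+ 2
  + 2 * n%:R * rad * path_variation xstar T
  + 2 * n%:R * rad ^+ 2.

(* Main.v *)
Require Import Defs.
From mathcomp Require Import all_boot all_order all_algebra.
From mathcomp Require Import all_classical all_reals all_analysis.
From mathcomp Require Import ring lra.

Import Order.TTheory GRing.Theory Num.Theory.
Import numFieldNormedType.Exports.

Local Open Scope classical_set_scope.
Local Open Scope ring_scope.

(** Weighted by the push-sum variables [phi], the squared distance to a point of
    [Omega] is a Lyapunov function: [phi_(t+1)^T B_t = phi_t^T], so averaging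
    does not increase it, and the step [alpha_t / phi_(i,t+1)] contributes the
    unweighted gradients.  Abel summation over the rounds [t < T] gives the
    [sqrt T] and path-variation terms.  In the last round no step is taken:
    AM-GM trades [G |x - u|] for the [sqrt T] multiple of the Lyapunov function
    left over by Abel summation, which yields [sqrt T] rather than
    [sqrt (T + 1)].  The disagreement between nodes obeys
    [D_(t+1) = lambda D_t + n C theta G alpha_t], since the projection moves the
    mixed iterate, itself a point of [Omega], by at most [theta G alpha_t]. *)

(** * Euclidean inner product and norm *)

Lemma edotC {R : realType} {m : nat} (u v : 'rV[R]_m) : edot u v = edot v u.
Proof. by apply: eq_bigr => k _; rewrite mulrC. Qed.

Lemma edotDr {R : realType} {m : nat} (u v w : 'rV[R]_m) :
  edot u (v + w) = edot u v + edot u w.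
Proof. by rewrite -big_split; apply: eq_bigr => k _; rewrite mxE mulrDr. Qed.

Lemma edotZr {R : realType} {m : nat} (a : R) (u v : 'rV[R]_m) :
  edot u (a *: v) = a * edot u v.
Proof. by rewrite big_distrr; apply: eq_bigr => k _; rewrite mxE mulrCA. Qed.

Lemma edotNr {R : realType} {m : nat} (u v : 'rV[R]_m) :
  edot u (- v) = - edot u v.
Proof. by rewrite -scaleN1r edotZr mulN1r. Qed.

Lemma edot0r {R : realType} {m : nat} (u : 'rV[R]_m) : edot u 0 = 0.
Proof. by rewrite -(scale0r 0) edotZr mul0r. Qed.

Lemma edotDl {R : realType} {m : nat} (u v w : 'rV[R]_m) :
  edot (u + v) w = edot u w + edot v w.
Proof. by rewrite edotC edotDr !(edotC w). Qed.

Lemma edotZl {R : realType} {m : nat} (a : R) (u v : 'rV[R]_m) :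
  edot (a *: u) v = a * edot u v.
Proof. by rewrite edotC edotZr edotC. Qed.

Lemma edotNl {R : realType} {m : nat} (u v : 'rV[R]_m) :
  edot (- u) v = - edot u v.
Proof. by rewrite edotC edotNr edotC. Qed.

Definition edotE {R : realType} {m : nat} :=
  (@edotDl R m, @edotDr R m, @edotZl R m, @edotZr R m, @edotNl R m,
   @edotNr R m).

Lemma edot_sumr {R : realType} {m : nat} {I : finType} (u : 'rV[R]_m)
    (v : I -> 'rV[R]_m) :
  edot u (\sum_i v i) = \sum_i edot u (v i).
Proof.
by apply: (big_morph (edot u)) => [v1 v2|]; rewrite ?edotDr ?edot0r.
Qed.

Lemma edot_ge0 {R : realType} {m : nat} (u : 'rV[R]_m) : 0 <= edot u u.
Proof. by apply: sumr_ge0 => k _; rewrite -expr2 sqr_ge0. Qed.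

Lemma enorm_ge0 {R : realType} {m : nat} (u : 'rV[R]_m) : 0 <= enorm u.
Proof. exact: sqrtr_ge0. Qed.

Lemma sqr_enorm {R : realType} {m : nat} (u : 'rV[R]_m) :
  enorm u ^+ 2 = edot u u.
Proof. by rewrite sqr_sqrtr ?edot_ge0. Qed.

Lemma enormZ {R : realType} {m : nat} (a : R) (u : 'rV[R]_m) :
  enorm (a *: u) = `|a| * enorm u.
Proof.
by rewrite /enorm !edotE mulrA -expr2 sqrtrM ?sqr_ge0// sqrtr_sqr.
Qed.

Lemma enormN {R : realType} {m : nat} (u : 'rV[R]_m) : enorm (- u) = enorm u.
Proof. by rewrite /enorm !edotE opprK. Qed.

Lemma enormB {R : realType} {m : nat} (u v : 'rV[R]_m) :
  enorm (u - v) = enorm (v - u).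
Proof. by rewrite -enormN opprB. Qed.

Lemma enorm0 {R : realType} {m : nat} : enorm (0 : 'rV[R]_m) = 0.
Proof. by rewrite /enorm edot0r sqrtr0. Qed.

Lemma enorm_eq0 {R : realType} {m : nat} (u : 'rV[R]_m) :
  (enorm u == 0) = (u == 0).
Proof.
apply/eqP/eqP => [u0|->]; last exact: enorm0.
have /psumr_eq0P uu0 : edot u u = 0 by rewrite -sqr_enorm u0 expr0n.
apply/rowP => k; rewrite mxE; apply/eqP; rewrite -sqrf_eq0 expr2.
by apply/eqP/uu0 => // i _; rewrite -expr2 sqr_ge0.
Qed.

(** Cauchy-Schwarz: expanding the square of [enorm v *: u - enorm u *: v] gives
    [2 |u| |v| (|u| |v| - u.v) >= 0], and for nonzero vectors the positive factor cancels. *)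
Lemma edot_le {R : realType} {m : nat} (u v : 'rV[R]_m) :
  edot u v <= enorm u * enorm v.
Proof.
have [->|u0] := eqVneq u 0; first by rewrite edotC edot0r enorm0 mul0r.
have [->|v0] := eqVneq v 0; first by rewrite edot0r enorm0 mulr0.
have uvgt0 : 0 < enorm u * enorm v.
  by rewrite mulr_gt0// lt_def enorm_eq0 ?u0 ?v0 enorm_ge0.
have := edot_ge0 (enorm v *: u - enorm u *: v).
rewrite !edotE -!sqr_enorm (edotC v u) => h.
rewrite -subr_ge0 -(pmulr_rge0 _ uvgt0).
by have := h; lra.
Qed.

Lemma sqr_enormB {R : realType} {m : nat} (u v : 'rV[R]_m) :
  enorm (u - v) ^+ 2 = enorm u ^+ 2 - 2 * edot u v + enorm v ^+ 2.
Proof. by rewrite !sqr_enorm !edotE (edotC v u); ring. Qed.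

Lemma enormD {R : realType} {m : nat} (u v : 'rV[R]_m) :
  enorm (u + v) <= enorm u + enorm v.
Proof.
rewrite -ler_sqr ?nnegrE ?addr_ge0 ?enorm_ge0//.
rewrite sqr_enorm !edotE (edotC v u) sqrrD !sqr_enorm.
by have := edot_le u v; lra.
Qed.

Lemma enorm_dist {R : realType} {m : nat} (w u v : 'rV[R]_m) :
  enorm (u - v) <= enorm (u - w) + enorm (v - w).
Proof. by rewrite (enormB v) -{1}(subrKA w u) enormD. Qed.

Lemma enorm_sum {R : realType} {m : nat} {I : Type} (r : seq I)
    (u : I -> 'rV[R]_m) :
  enorm (\sum_(i <- r) u i) <= \sum_(i <- r) enorm (u i).
Proof.
elim/big_ind2 : _ => [|u1 a1 u2 a2 h1 h2|//]; first by rewrite enorm0.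
exact: le_trans (enormD _ _) (lerD h1 h2).
Qed.

(** Jensen for the squared norm: the variance of the [v i] under the weights [b] is nonnegative. *)
Lemma sqr_enorm_weighted_sum {R : realType} {m : nat} {I : finType}
    (b : I -> R) (v : I -> 'rV[R]_m) :
  (forall i, 0 <= b i) -> \sum_i b i = 1 ->
  enorm (\sum_i b i *: v i) ^+ 2 <= \sum_i b i * enorm (v i) ^+ 2.
Proof.
move=> b0 b1; set y := \sum_i _.
have : 0 <= \sum_i b i * edot (v i - y) (v i - y).
  by apply: sumr_ge0 => i _; rewrite mulr_ge0 ?edot_ge0.
rewrite (eq_bigr (fun i => b i * enorm (v i) ^+ 2 + b i * enorm y ^+ 2
    - 2 * edot y (b i *: v i))); last first.
  by move=> i _; rewrite !edotE (edotC (v i) y) -!sqr_enorm; ring.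
rewrite big_split/= sumrN -mulr_sumr -edot_sumr -/y big_split/= -mulr_suml b1.
by rewrite -sqr_enorm; lra.
Qed.

(** * Convexity, subgradients and projection *)

Lemma convex_functionP {R : realType} {m : nat} {f : 'rV[R]_m -> R} :
  convex_function setT f ->
  forall (a : R) u v, 0 <= a -> a <= 1 ->
    f (a *: u + (1 - a) *: v) <= a * f u + (1 - a) * f v.
Proof.
move=> fc a u v a0 a1.
by have := fc (Itv01 a0 a1) u v; rewrite !inE; apply.
Qed.

Lemma convex_setP {R : realType} {m : nat} {Omega : set 'rV[R]_m} :
  convex_set Omega ->
  forall (a : R) u v, Omega u -> Omega v -> 0 <= a -> a <= 1 ->
    Omega (a *: u + (1 - a) *: v).
Proof.
move=> oc a u v ou ov a0 a1.
by have := oc u v (Itv01 a0 a1); rewrite !inE; apply.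
Qed.

(* Hahn-Banach, one coordinate at a time: [c] below separates the difference
   quotients of [f] at negative and positive steps along the new coordinate. *)
Lemma subgradient_on_coordinates {R : realType} {m : nat}
    (f : 'rV[R]_m -> R) (x : 'rV[R]_m) (k : nat) :
  convex_function setT f ->
  exists g : 'rV[R]_m, forall v : 'rV[R]_m,
    (forall i : 'I_m, (k <= i)%N -> v 0 i = 0) ->
    f x + edot g v <= f (x + v).
Proof.
move=> fc; elim: k => [|k [g gP]].
  exists 0 => v v0; have -> : v = 0 by apply/rowP => i; rewrite v0// mxE.
  by rewrite edot0r !addr0.
have [mk|km] := leqP m k.
  exists g => v _; apply: gP => i ki.
  by have := leq_trans (ltn_ord i) (leq_trans mk ki); rewrite ltnn.
pose ik := Ordinal km; pose e : 'rV[R]_m := delta_mx 0 ik.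
pose V := [set v : 'rV[R]_m | forall i : 'I_m, (k <= i)%N -> v 0 i = 0].
(* The weight [a = s' / (s + s')] cancels the two displacements along [e], so the convex combination
   lies in [x + V], where the induction hypothesis on [g] applies. *)
have slopes w w' s s' : V w -> V w' -> 0 < s -> 0 < s' ->
    (f x + edot g w - f (x + w - s *: e)) / s
    <= (f (x + w' + s' *: e) - f x - edot g w') / s'.
  move=> Vw Vw' s0 s0'.
  have ss0 : 0 < s + s' by rewrite addr_gt0.
  pose a := s' / (s + s').
  have a1 : 1 - a = s / (s + s') by rewrite /a; field; rewrite gt_eqF.
  have a0 : 0 <= a by rewrite divr_ge0 ?ltW.
  have a0' : 0 <= 1 - a by rewrite a1 divr_ge0 ?ltW.
  have ub : f x + edot g (a *: w + (1 - a) *: w') <=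
      f (a *: (x + w - s *: e) + (1 - a) *: (x + w' + s' *: e)).
    have -> : a *: (x + w - s *: e) + (1 - a) *: (x + w' + s' *: e)
        = x + (a *: w + (1 - a) *: w').
      rewrite a1 /a; apply/rowP => i; rewrite !mxE; field.
      by rewrite gt_eqF.
    by apply: gP => i ki; rewrite !mxE Vw// Vw'// !mulr0 addr0.
  have {}ub := le_trans ub (convex_functionP fc _ _ _ a0 ltac:(lra)).
  rewrite ler_pdivrMr// mulrAC ler_pdivlMr//.
  move: ub; rewrite !edotE -subr_ge0 -(pmulr_rge0 _ ss0).
  rewrite -[in X in _ -> X]subr_ge0.
  set P := f (x + w - _); set Q := f (x + w' + _).
  set L := (X in 0 <= X -> _); set U := (X in _ -> is_true (0 <= X)).
  suff -> : L = U by [].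
  by rewrite /L /U a1 /a; field; rewrite gt_eqF.
have V0 : V 0 by move=> i _; rewrite mxE.
pose S := [set c | exists w s, [/\ V w, 0 < s &
    c = (f x + edot g w - f (x + w - s *: e)) / s]].
have S0 : S !=set0.
  by exists ((f x + edot g 0 - f (x + 0 - 1 *: e)) / 1), 0, 1.
have Sub w' s' : V w' -> 0 < s' ->
    ubound S ((f (x + w' + s' *: e) - f x - edot g w') / s').
  by move=> Vw' s0' _ [w [s [Vw s0 ->]]]; apply: slopes.
have Ssup : has_sup S by split=> //; eexists; apply: (Sub 0 1).
pose c := sup S.
have ew w : V w -> edot e w = 0.
  move=> Vw; rewrite /edot big1// => i _; rewrite mxE eqxx/=.
  by case: eqVneq => [->|_]; rewrite ?mul0r// Vw ?mulr0 /=.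
have ee : edot e e = 1.
  rewrite /edot (bigD1 ik)//= big1 ?addr0 => [|i /negPf ik0].
    by rewrite !mxE !eqxx mulr1.
  by rewrite !mxE ik0 andbF mulr0.
(* As [e] is a unit vector orthogonal to [V], replacing the component of [g] along [e] by [c] leaves
   its values on [V] unchanged. *)
have gE w s : V w ->
    edot (g + (c - edot g e) *: e) (w + s *: e) = edot g w + s * c.
  by move=> Vw; rewrite !edotE (ew _ Vw) ee; ring.
have extension w s : V w ->
    f x + (edot g w + s * c) <= f (x + (w + s *: e)).
  move=> Vw; rewrite (addrA x); have [s0|s0|->] := ltgtP s 0.
  - have : (f x + edot g w - f (x + w - (- s) *: e)) / (- s) <= c.
      by apply: sup_upper_bound => //; exists w, (- s); rewrite oppr_gt0.
    by rewrite ler_pdivrMr ?oppr_gt0// scaleNr opprK; lra.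
  - have : c <= (f (x + w + s *: e) - f x - edot g w) / s by exact/ge_sup/Sub.
    by rewrite ler_pdivlMr//; lra.
  - by rewrite scale0r mul0r !addr0; apply: gP.
exists (g + (c - edot g e) *: e) => v v0.
have Vw : V (v - v 0 ik *: e).
  move=> i ki; rewrite !mxE eqxx/=; have [->|ii] := eqVneq i ik.
    by rewrite mulr1 subrr.
  rewrite v0 ?mulr0 ?subr0// ltn_neqAle ki andbT eq_sym.
  by apply: contraNneq ii => ii; apply/eqP/val_inj.
by have := extension _ (v 0 ik) Vw; rewrite -gE// subrK.
Qed.

Lemma subgradient_exists {R : realType} {m : nat} (f : 'rV[R]_m -> R)
    (x : 'rV[R]_m) :
  convex_function setT f -> exists g, subdifferential f x g.
Proof.
move=> fc; have [g gP] := subgradient_on_coordinates f x m fc.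
exists g => y; rewrite -[X in _ <= f X](subrKC x y); apply: gP => i.
by rewrite leqNgt ltn_ord.
Qed.

(** Induction on [n]: the first weight is split off and the others are rescaled by their sum [c],
    the case [c = 0] being separate. *)
Lemma convex_set_sum {R : realType} {m : nat} {Omega : set 'rV[R]_m}
    (n : nat) (b : 'I_n -> R) (v : 'I_n -> 'rV[R]_m) :
  convex_set Omega -> (forall i, 0 <= b i) -> \sum_i b i = 1 ->
  (forall i, Omega (v i)) -> Omega (\sum_i b i *: v i).
Proof.
move=> oc; elim: n b v => [|n IH] b v b0 b1 ov.
  by move: b1 => /eqP; rewrite big_ord0 eq_sym oner_eq0.
move: b1; rewrite !big_ord_recl/=; set c := \sum_i b _ => b1.
have c0 : 0 <= c by apply: sumr_ge0.
have {}b1 : b ord0 = 1 - c by lra.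
have [c00|cn0] := eqVneq c 0.
  rewrite big1 => [|i _]; first by rewrite b1 c00 subr0 scale1r addr0.
  by move/psumr_eq0P : c00 => ->//; rewrite scale0r.
have -> : \sum_(i < n) b (lift ord0 i) *: v (lift ord0 i) =
    c *: \sum_(i < n) (b (lift ord0 i) / c) *: v (lift ord0 i).
  rewrite scaler_sumr; apply: eq_bigr => i _.
  by rewrite scalerA mulrCA divff// mulr1.
rewrite b1 addrC; apply: convex_setP => //.
  apply: IH => [i||//]; first by rewrite divr_ge0.
  by rewrite -mulr_suml divff.
by have := b0 ord0; lra.
Qed.

(** Comparing [p] with points of the segment from [p] to [u] yields the variational inequality
    [d <= 0]; expanding [|y - u|^2] around [p] then gives the bound. *)
Lemma is_proj_dist {R : realType} {m : nat} {Omega : set 'rV[R]_m}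
    (y p u : 'rV[R]_m) :
  convex_set Omega -> is_proj Omega y p -> Omega u ->
  enorm (p - u) <= enorm (y - u).
Proof.
move=> oc [op pmin] ou.
set d := edot (y - p) (u - p).
have d0 : d <= 0.
  have h t : 0 < t -> t <= 1 -> 2 * d <= t * enorm (u - p) ^+ 2.
    move=> t0 t1.
    have := pmin _ (convex_setP oc _ _ _ ou op (ltW t0) t1).
    have -> : y - (t *: u + (1 - t) *: p) = (y - p) - t *: (u - p).
      by apply/rowP => i; rewrite !mxE; ring.
    rewrite -ler_sqr ?nnegrE ?enorm_ge0//.
    rewrite [leRHS]sqr_enormB edotZr -/d enormZ (ger0_norm (ltW t0)) => h.
    by rewrite -(ler_pM2l t0); lra.
  rewrite leNgt; apply/negP => d0; set N := enorm (u - p) ^+ 2 in h.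
  have N0 : 0 <= N by rewrite sqr_ge0.
  have Nd0 : 0 < N + d by lra.
  (* This step length lies in [(0, 1]] even when [N = 0], and turns [h] into [2 d (N + d) <= d N],
     impossible for [d > 0]. *)
  have := h (d / (N + d)); rewrite divr_gt0// ler_pdivrMr// mul1r.
  move=> /(_ isT); rewrite lerDr N0 => /(_ isT).
  rewrite mulrAC ler_pdivlMr//; nra.
rewrite -ler_sqr ?nnegrE ?enorm_ge0//.
have -> : y - u = (y - p) - (u - p) by apply/rowP => i; rewrite !mxE; ring.
rewrite (enormB p) [leRHS]sqr_enormB -/d.
by have := sqr_ge0 (enorm (y - p)); lra.
Qed.

(** * Scalar sums: step sizes, Abel summation, geometric filters *)

(** Consecutive square roots satisfy [1 / b <= 2 (b - a)], a form of [(b - a)^2 >= 0], and the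
    right-hand sides telescope. The [- 1] later absorbs the constant left by the last round. *)
Lemma sum_inv_sqrt {R : realType} (T : nat) :
  \sum_(0 <= t < T.+1) (1 / Num.sqrt t.+1%:R : R)
    <= 2 * Num.sqrt T.+1%:R - 1.
Proof.
elim: T => [|T IH]; first by rewrite big_nat1 sqrtr1 divr1; lra.
rewrite big_nat_recr//=; apply: le_trans (lerD IH (lexx _)) _.
set a := Num.sqrt T.+1%:R; set b := Num.sqrt T.+2%:R.
have b0 : 0 < b by rewrite sqrtr_gt0.
have ab : b ^+ 2 = a ^+ 2 + 1 by rewrite !sqr_sqrtr// -[T.+2]addn1 natrD.
suff : 1 / b <= 2 * b - 2 * a by lra.
by rewrite ler_pdivrMr//; have := sqr_ge0 (b - a); nra.
Qed.

(** After summation by parts each [W t] with [t < T] has coefficient [c t.+1 - c t >= 0], so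
    [W t <= M] applies and the increments telescope. The boundary term [c T * W T] stays on the left
    to pay for the last round. *)
Lemma abel_sum_le {R : realType} (c W : nat -> R) (M : R) (T : nat) :
  c 0%N = 0 -> (forall t, c t <= c t.+1) -> (forall t, W t <= M) ->
  \sum_(0 <= t < T) c t.+1 * (W t - W t.+1) + c T * W T <= c T * M.
Proof.
move=> c0 cS WM; elim: T => [|T IH]; first by rewrite big_nil c0 !mul0r addr0.
rewrite big_nat_recr//=.
have : (c T.+1 - c T) * W T <= (c T.+1 - c T) * M.
  by rewrite ler_wpM2l// subr_ge0.
by lra.
Qed.

(** The recursive form makes sums over time telescope; the closed form [geometric_filterE] is the
    one in which the consensus estimate arises. *)
Fixpoint geometric_filter {R : realType} (lambda a : R) (b : nat -> R)
    (t : nat) : R :=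
  if t is s.+1 then lambda * geometric_filter lambda a b s + b s else a.

Lemma geometric_filterE {R : realType} (lambda a : R) (b : nat -> R) (t : nat) :
  geometric_filter lambda a b t =
  lambda ^+ t * a + \sum_(0 <= s < t) lambda ^+ (t - s.+1) * b s.
Proof.
elim: t => [|t IH]/=; first by rewrite big_nil mul1r addr0.
rewrite big_nat_recr//= subnn mul1r IH mulrDr mulrA -exprS addrA.
congr (_ + _ + _); rewrite mulr_sumr; apply: eq_big_nat => s /andP[_ st].
by rewrite mulrA -exprS subSn.
Qed.

Lemma geometric_filter_ge0 {R : realType} (lambda a : R) (b : nat -> R) t :
  0 <= lambda -> 0 <= a -> (forall s, 0 <= b s) ->
  0 <= geometric_filter lambda a b t.
Proof. by move=> l0 a0 b0; elim: t => //= t IH; rewrite addr_ge0 ?mulr_ge0. Qed.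

(** Summing the recurrence gives an identity in which the only discarded term is
    [lambda * D T >= 0]. *)
Lemma sum_geometric_filter {R : realType} (lambda a : R) (b : nat -> R) T :
  0 <= lambda -> 0 <= a -> (forall s, 0 <= b s) ->
  (1 - lambda) * \sum_(0 <= t < T.+1) geometric_filter lambda a b t
    <= a + \sum_(0 <= t < T) b t.
Proof.
move=> l0 a0 b0; set D := geometric_filter lambda a b.
suff : lambda * D T + (1 - lambda) * \sum_(0 <= t < T.+1) D t
    = a + \sum_(0 <= t < T) b t.
  have := mulr_ge0 l0 (geometric_filter_ge0 lambda a b T l0 a0 b0).
  by rewrite -/D; lra.
have DS t : D t.+1 = lambda * D t + b t by [].
elim: T => [|T IH]; first by rewrite big_nat1 big_nil /D/=; ring.
by rewrite [in RHS]big_nat_recr//= addrA -IH big_nat_recr//= !DS; ring.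
Qed.

(** * Push-sum weights and consensus *)

(** Column-stochasticity conserves the total mass of the initial all-ones vector. *)
Lemma phi_sum {R : realType} {n : nat} (A : nat -> 'M[R]_n) (t : nat) :
  (forall t, (A t)^T *m const_mx 1 = const_mx 1 :> 'cV[R]_n) ->
  \sum_i phi A t i 0 = n%:R.
Proof.
move=> A1; have sumE (v : 'cV[R]_n) : (const_mx 1)^T *m v = (\sum_i v i 0)%:M.
  apply/matrixP => i j; rewrite !mxE !ord1; apply: eq_bigr => k _.
  by rewrite !mxE mul1r.
have : (const_mx 1 : 'cV[R]_n)^T *m phi A t = n%:R%:M.
  elim: t => [|t IH] /=.
    rewrite sumE (eq_bigr (fun=> 1)) ?sumr_const ?card_ord// => i _.
    by rewrite mxE.
  by rewrite mulmxA -{1}[A t]trmxK -trmx_mul A1.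
by rewrite sumE => /matrixP/(_ 0 0); rewrite !mxE !eqxx.
Qed.

Lemma Bmx_row_sum {R : realType} {n : nat} (A : nat -> 'M[R]_n) t i :
  phi A t.+1 i 0 != 0 -> \sum_j Bmx A t i j = 1.
Proof.
have phiS : phi A t.+1 i 0 = \sum_j A t i j * phi A t j 0 by rewrite mxE.
move=> phin0.
rewrite (eq_bigr (fun j => A t i j * phi A t j 0 / phi A t.+1 i 0)).
  by rewrite -mulr_suml -phiS divff.
by move=> j _; rewrite mxE.
Qed.

(** The factor [phi A t.+1 i 0] cancels the denominator of [Bmx], leaving [phi A t j 0] times a
    column sum of [A t]. *)
Lemma Bmx_phi {R : realType} {n : nat} (A : nat -> 'M[R]_n) t j :
  (forall t, (A t)^T *m const_mx 1 = const_mx 1 :> 'cV[R]_n) ->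
  (forall i, phi A t.+1 i 0 != 0) ->
  \sum_i phi A t.+1 i 0 * Bmx A t i j = phi A t j 0.
Proof.
move=> A1 phin0.
under eq_bigr => i _ do rewrite [Bmx _ _ _ _]mxE mulrC divfK//.
have /matrixP/(_ j 0) := A1 t; rewrite !mxE -mulr_suml => A1j.
rewrite (eq_bigr (fun i => (A t)^T j i * const_mx 1 i (0 : 'I_1))).
  by rewrite A1j mul1r.
by move=> i _; rewrite !mxE mulr1.
Qed.

(** Variation of constants: [Er s] enters after [Bmx A s] has acted, so only the factors from index
    [s.+1] on propagate it. *)
Lemma Bprod_unroll {R : realType} {n m : nat} (A : nat -> 'M[R]_n)
    (X Er : nat -> 'M[R]_(n, m)) (t : nat) :
  (forall t, X t.+1 = Bmx A t *m X t + Er t) ->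
  X t = Bprod A t 0 *m X 0 + \sum_(0 <= s < t) Bprod A t s.+1 *m Er s.
Proof.
move=> XS; elim: t => [|t IH]; first by rewrite big_nil addr0 mul1mx.
rewrite XS {}IH mulmxDr mulmxA big_nat_recr//= ltnn mul1mx addrA.
congr (_ + _ + _); rewrite mulmx_sumr; apply: eq_big_nat => s /andP[_ st].
by rewrite st mulmxA.
Qed.

(** All nodes are compared with one common trajectory [z]; unrolling the recursion reduces each
    distance to entrywise errors of [Bprod], which decay geometrically. *)
Lemma consensus_error {R : realType} {n m : nat} (A : nat -> 'M[R]_n)
    (C lambda : R) (p : nat -> 'cV[R]_n) (x e : 'I_n -> nat -> 'rV[R]_m)
    (eps : nat -> R) :
  (forall i j s t, (t <= s)%N ->
     `|Bprod A s t i j - p t j 0| <= C * lambda ^+ (s - t)) ->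
  (forall i t, x i t.+1 = \sum_j Bmx A t i j *: x j t + e i t) ->
  (forall i t, enorm (e i t) <= eps t) ->
  0 <= C -> 0 <= lambda ->
  exists z : nat -> 'rV[R]_m, forall i t,
    enorm (x i t - z t) <= geometric_filter lambda
      (C * \sum_i enorm (x i 0%N)) (fun s => C * n%:R * eps s) t.
Proof.
move=> BpC xS ee C0 l0.
have rowE (M : 'M[R]_n) (v : 'I_n -> 'rV[R]_m) i :
    row i (M *m \matrix_j v j) = \sum_j M i j *: v j.
  rewrite row_mul mulmx_sum_row; apply: eq_bigr => j _.
  by rewrite rowK mxE.
have unroll i t : x i t = \sum_j Bprod A t 0 i j *: x j 0%N
    + \sum_(0 <= s < t) \sum_j Bprod A t s.+1 i j *: e j s.
  have := Bprod_unroll A (fun t => \matrix_i x i t)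
    (fun t => \matrix_i e i t) t.
  move=> /(_ _)/(congr1 (row i)); rewrite rowK => ->; last first.
    by move=> s; apply/row_matrixP => k; rewrite linearD/= rowE !rowK xS.
  rewrite linearD/= rowE linear_sum/=; congr (_ + _).
  by apply: eq_bigr => s _; rewrite rowE.
have term s t i (v : 'I_n -> 'rV[R]_m) : (t <= s)%N ->
    enorm (\sum_j Bprod A s t i j *: v j - \sum_j p t j 0 *: v j)
    <= C * lambda ^+ (s - t) * \sum_j enorm (v j).
  move=> ts; rewrite -sumrB mulr_sumr; apply: le_trans (enorm_sum _ _) _.
  apply: ler_sum => j _; rewrite -scalerBl enormZ.
  by rewrite ler_wpM2r ?enorm_ge0 ?BpC.
(* The unrolled formula for [x i t] with every row of [Bprod A t s] replaced by its limit [p s],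
   hence independent of [i]. *)
exists (fun t => \sum_j p 0%N j 0 *: x j 0%N
    + \sum_(0 <= s < t) \sum_j p s.+1 j 0 *: e j s) => i t.
rewrite unroll geometric_filterE opprD addrACA.
apply: le_trans (enormD _ _) (lerD _ _).
    apply: le_trans (term t 0%N i (x ^~ 0%N) isT) _.
  by rewrite subn0 -mulrA mulrCA.
rewrite -sumrB; apply: le_trans (enorm_sum _ _) _.
rewrite big_nat [leRHS]big_nat.
apply: ler_sum => s /andP[_ st].
apply: le_trans (term _ _ _ _ st) _.
rewrite -mulrA mulrCA ler_wpM2l ?exprn_ge0// -mulrA ler_wpM2l//.
apply: le_trans (_ : _ <= \sum_(j < n) eps s) _; first exact: ler_sum.
by rewrite sumr_const card_ord mulr_natl.
Qed.

(** * One round of the algorithm and the scalar bookkeeping *)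

(** Multiplying the projected step by [phi' i] turns its cross term into [2 alpha] times an inner
    product with [g i], free of [phi'], and its quadratic term into at most [alpha^2 theta G^2].
    Jensen then passes from [y] back to [x]. *)
Lemma projected_subgradient_round {R : realType} {n m : nat}
    (Omega : set 'rV[R]_m) (f : 'I_n -> 'rV[R]_m -> R)
    (phi phi' : 'I_n -> R) (B : 'M[R]_n) (x g x' : 'I_n -> 'rV[R]_m)
    (u : 'rV[R]_m) (alpha theta G : R)
    (y := fun i => \sum_j B i j *: x j) :
  convex_set Omega -> Omega u ->
  (forall i, 0 < phi' i) -> (forall i, (phi' i)^-1 <= theta) ->
  (forall i j, 0 <= B i j) -> (forall i, \sum_j B i j = 1) ->
  (forall j, \sum_i phi' i * B i j = phi j) ->
  (forall i, subdifferential (f i) (x i) (g i)) ->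
  (forall i, enorm (g i) <= G) -> 0 < alpha ->
  (forall i, is_proj Omega (y i - (alpha / phi' i) *: g i) (x' i)) ->
  2 * alpha * \sum_i (f i (x i) - f i u)
    <= \sum_i phi i * enorm (x i - u) ^+ 2
       - \sum_i phi' i * enorm (x' i - u) ^+ 2
       + 2 * alpha * (G * \sum_i enorm (y i - x i))
       + alpha ^+ 2 * (n%:R * theta * G ^+ 2).
Proof.
move=> oc ou phi0 phith B0 B1 Bphi gsub gG a0 xproj.
have jensen : \sum_i phi' i * enorm (y i - u) ^+ 2
    <= \sum_i phi i * enorm (x i - u) ^+ 2.
  apply: le_trans (_ : _ <= \sum_i \sum_j
      phi' i * (B i j * enorm (x j - u) ^+ 2)) _.
    apply: ler_sum => i _; rewrite -mulr_sumr ler_pM2l//.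
    have -> : y i - u = \sum_j B i j *: (x j - u).
      under [RHS]eq_bigr do rewrite scalerBr.
      by rewrite sumrB -scaler_suml B1 scale1r.
    exact: sqr_enorm_weighted_sum.
  rewrite exchange_big/=; apply: ler_sum => j _.
  by under eq_bigr do rewrite mulrA; rewrite -mulr_suml Bphi.
have step i : 2 * alpha * (f i (x i) - f i u)
    <= phi' i * enorm (y i - u) ^+ 2 - phi' i * enorm (x' i - u) ^+ 2
       + 2 * alpha * G * enorm (y i - x i) + alpha ^+ 2 * theta * G ^+ 2.
  have h1 : phi' i * enorm (x' i - u) ^+ 2 <= phi' i * enorm (y i - u) ^+ 2
      - 2 * alpha * edot (y i - u) (g i)
      + alpha ^+ 2 / phi' i * enorm (g i) ^+ 2.
    have -> : phi' i * enorm (y i - u) ^+ 2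
        - 2 * alpha * edot (y i - u) (g i)
        + alpha ^+ 2 / phi' i * enorm (g i) ^+ 2
        = phi' i * enorm (y i - u - (alpha / phi' i) *: g i) ^+ 2.
      rewrite (sqr_enormB (y i - u)) edotZr enormZ exprMn.
      rewrite real_normK ?num_real//.
      by field; rewrite gt_eqF.
    rewrite ler_pM2l// ler_sqr ?nnegrE ?enorm_ge0// (addrAC (y i)).
    exact: (is_proj_dist _ _ _ oc (xproj i) ou).
  (* The subgradient is taken at [x i] but the step starts from [y i]; Cauchy-Schwarz charges the
     mismatch [G |y i - x i|]. *)
  have h2 : f i (x i) - f i u - G * enorm (y i - x i) <= edot (y i - u) (g i).
    have -> : edot (y i - u) (g i)
        = edot (y i - x i) (g i) + edot (x i - u) (g i).
      by rewrite !edotE; ring.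
    have := gsub i u; rewrite -(opprB (x i) u) edotNr edotC.
    have := edot_le (x i - y i) (g i); rewrite enormB -(opprB (y i)) edotNl.
    have := ler_wpM2l (enorm_ge0 (y i - x i)) (gG i).
    by lra.
  have h3 : alpha ^+ 2 / phi' i * enorm (g i) ^+ 2
      <= alpha ^+ 2 * theta * G ^+ 2.
    rewrite -!(mulrA (alpha ^+ 2)); apply: (ler_wpM2l (sqr_ge0 alpha)).
    apply: ler_pM => //; rewrite ?invr_ge0 ?sqr_ge0 ?(ltW (phi0 i))//.
    by rewrite ler_sqr ?nnegrE ?enorm_ge0// (le_trans _ (gG i)) ?enorm_ge0.
  have := ler_wpM2l (ltW a0) h2; lra.
rewrite mulr_sumr; apply: le_trans (ler_sum _ (fun i _ => step i)) _.
rewrite !big_split/= sumrN -mulr_sumr sumr_const card_ord -mulr_natl.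
by have := jensen; lra.
Qed.

(** Cost of moving the comparator: in [a^2 - b^2 = (a - b)(a + b)] the first factor is at most
    [|v - u|] and the second at most [4 rad]. *)
Lemma sqr_enorm_shift {R : realType} {m : nat} (rad : R) (x u v : 'rV[R]_m) :
  enorm x <= rad -> enorm u <= rad -> enorm v <= rad ->
  enorm (x - v) ^+ 2 <= enorm (x - u) ^+ 2 + 4 * rad * enorm (v - u).
Proof.
move=> xr ur vr.
have h (w : 'rV[R]_m) : enorm w <= rad -> enorm (x - w) <= 2 * rad.
  by move=> wr; have := enormD x (- w); rewrite enormN; lra.
have := h _ ur; have := h _ vr; have := enorm_dist u x v.
have := enorm_ge0 (x - v); have := enorm_ge0 (x - u); have := enorm_ge0 (v - u).
set a := enorm (x - v); set b := enorm (x - u); set d := enorm (v - u).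
move=> d0 b0 a0 abd ar br.
have : (a - b) * (a + b) <= d * (a + b) by apply: ler_wpM2r; lra.
have : d * (a + b) <= d * (4 * rad) by apply: ler_wpM2l; lra.
by lra.
Qed.

(** The bound [G] concerns subgradients only, so one must first exist at [u]; its inequality, tested
    at [v], gives the estimate. *)
Lemma subgradient_bound_lipschitz {R : realType} {m : nat}
    (Omega : set 'rV[R]_m) (f : 'rV[R]_m -> R) (G : R) (u v : 'rV[R]_m) :
  convex_function setT f ->
  (forall x g, Omega x -> subdifferential f x g -> enorm g <= G) ->
  Omega u -> f u - f v <= G * enorm (u - v).
Proof.
move=> fc fG ou; have [g gsub] := subgradient_exists f u fc.
have := gsub v; rewrite -(opprB u v) edotNr.
have := edot_le g (u - v).
have := ler_wpM2r (enorm_ge0 (u - v)) (fG _ _ ou gsub).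
by lra.
Qed.

(* The argument gives [4 n C G S / (1 - lambda)], whose coefficient may exceed
   that of K3; since [1 <= theta] the excess is at most
   [n C G S / (1 - lambda)], absorbed by the second term of K3 through [S <= n rad]. *)
Lemma regret_constants {R : realType} (N C lambda theta G rad S P s D : R) :
  0 <= N -> 0 < C -> 0 < lambda -> lambda < 1 -> 1 <= theta -> 0 < G ->
  0 < rad -> S <= N * rad -> 0 <= S -> 0 <= s ->
  (1 - lambda) * D <= C * S + C * N * (theta * G) * (2 * s) ->
  2 * N * rad ^+ 2 * s + 2 * N * rad * P * s + N * theta * G ^+ 2 * s
    + 4 * N * G * D
  <= (2 * theta * lambda + theta + 2) * N * C * G / (1 - lambda) * S
     + 2 * N ^+ 2 * theta * C * G * rad / (lambda * (1 - lambda))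
     + (2 * (3 * theta + 2) * N ^+ 2 * theta * C * G ^+ 2 / (1 - lambda)
        + N * theta ^+ 2 * G ^+ 2 + 2 * N * rad * P + 2 * N * rad ^+ 2) * s.
Proof.
move=> N0 C0 l0 l1 th1 G0 r0 Sr S0 s0 hD.
set q := (1 - lambda)^-1; set r := (lambda * (1 - lambda))^-1.
have l1' : 0 < 1 - lambda by lra.
have q0 : 0 < q by rewrite invr_gt0.
have qr : q <= r.
  by rewrite lef_pV2 ?posrE ?mulr_gt0// ler_piMl ?ltW.
have [[[[C0' G0'] l0'] r0'] q0'] := (ltW C0, ltW G0, ltW l0, ltW r0, ltW q0).
have th0 : 0 <= theta by lra.
have r0'' := le_trans q0' qr.
have NCG : 0 <= N * C * G by rewrite !mulr_ge0.
have {}hD : D <= q * (C * S + C * N * (theta * G) * (2 * s)).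
  by rewrite /q mulrC ler_pdivlMr// mulrC.
have h1 : 4 * N * G * D
    <= 4 * N * C * G * q * S + 8 * N ^+ 2 * theta * C * G ^+ 2 * q * s.
  have NG : 0 <= 4 * N * G by rewrite !mulr_ge0.
  by have := ler_wpM2l NG hD; lra.
have h2 : N * theta * G ^+ 2 * s <= N * theta ^+ 2 * G ^+ 2 * s.
  have : N * G ^+ 2 * s * theta * 1 <= N * G ^+ 2 * s * theta * theta.
    by rewrite ler_wpM2l// !mulr_ge0 ?sqr_ge0.
  by lra.
(* From [1 <= theta], the factor [2 * (3 * theta + 2)] is at least 10. *)
have h3 : 8 * N ^+ 2 * theta * C * G ^+ 2 * q * s
    <= 2 * (3 * theta + 2) * N ^+ 2 * theta * C * G ^+ 2 * q * s.
  have : N ^+ 2 * theta * C * G ^+ 2 * q * s * 8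
      <= N ^+ 2 * theta * C * G ^+ 2 * q * s * (2 * (3 * theta + 2)).
    by apply: ler_wpM2l; [rewrite !mulr_ge0 ?sqr_ge0|lra].
  by lra.
have h4 : 4 * N * C * G * q * S <=
    (2 * theta * lambda + theta + 2) * N * C * G * q * S
    + 2 * N ^+ 2 * theta * C * G * rad * r.
  have NCGq : 0 <= N * C * G * q by rewrite mulr_ge0.
  have e1 : N * C * G * q * S * (2 - theta - 2 * theta * lambda)
      <= N * C * G * q * S * 1.
    apply: ler_wpM2l; first by rewrite mulr_ge0.
    by have := mulr_ge0 th0 l0'; lra.
  have e2 : N * C * G * q * S <= N * C * G * q * (N * rad) by apply: ler_wpM2l.
  have e3 : N * C * G * (N * rad) * q <= N * C * G * (N * rad) * r.
    by apply: ler_wpM2l qr; rewrite !mulr_ge0.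
  have e4 : N * C * G * (N * rad) * r * 1
      <= N * C * G * (N * rad) * r * (2 * theta).
    apply: ler_wpM2l; last lra.
    by rewrite !mulr_ge0.
  by lra.
by lra.
Qed.

(** * The dynamic regret bound *)

Theorem theorem3 (R : realType) (n m : nat)
    (E : nat -> rel 'I_n) (A : nat -> 'M[R]_n)
    (Omega : set 'rV[R]_m) (f : 'I_n -> nat -> 'rV[R]_m -> R)
    (rad G C lambda theta : R)
    (x : 'I_n -> nat -> 'rV[R]_m) (xstar : nat -> 'rV[R]_m)
    (hE : weighted_digraphs E A)
    (hG : assumption_G E A)
    (hf : forall i t, convex_function setT (f i t))
    (hC : assumption_C Omega f rad G)
    (hconst : network_constants A C lambda theta)
    (hx : algorithm2 A Omega f (fun t => 1 / Num.sqrt (t.+1%:R)) x)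
    (hxstar : forall t, argmin Omega (total_cost f t) (xstar t))
    (T : nat) (hT : (0 < T)%N) (j : 'I_n) :
  dynamic_regret f x xstar j T
    <= K3 C lambda theta G rad x
       + K4 n C lambda theta G rad xstar T * Num.sqrt (T%:R).
Proof.
have [_ A1 _] := hG.
have [[_ oc _] [r [_ rad0 _ oball]] [G0 gG]] := hC.
have [[C0 l0 l1 th0] [p [_ _ _ BpC]] phith] := hconst.
have [x0 [g gx]] := hx.
have gsub i t : subdifferential (f i t) (x i t) (g i t) by case: (gx i t).
have xproj i t := (gx i t).2.
pose alpha t : R := 1 / Num.sqrt t.+1%:R.
have a0 t : 0 < alpha t by rewrite divr_gt0// sqrtr_gt0.
have ox i t : Omega (x i t) by case: t => [//|t]; case: (xproj i t).
have os t : Omega (xstar t) by case: (hxstar t).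
have xr i t : enorm (x i t) <= rad := oball _ (ox i t).
have sr t : enorm (xstar t) <= rad := oball _ (os t).
have gG' i t : enorm (g i t) <= G by apply: gG (gsub i t).
(* At time 0 every [phi] equals 1, so the lower bound reads [theta^-1 <= 1]. *)
have th1 : 1 <= theta by have := phith j 0%N; rewrite /= mxE invf_le1.
have phi0 i t : 0 < phi A t i 0.
  by apply: lt_le_trans (phith i t); rewrite invr_gt0.
have phin0 t i : phi A t i 0 != 0 by rewrite gt_eqF.
have phiV i t : (phi A t i 0)^-1 <= theta by rewrite invf_ple ?posrE.
have A0 t i k : 0 <= A t i k.
  have [pos zero] := hE.2 t i k.
  by have [/pos/ltW//|/zero->] := boolP (E t k i).
have B0 t i k : 0 <= Bmx A t i k.
  by rewrite mxE divr_ge0 ?mulr_ge0 ?A0 ?ltW ?(phi0 _ t.+1).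
have B1 t i : \sum_k Bmx A t i k = 1 by apply: Bmx_row_sum.
pose y i t := \sum_k Bmx A t i k *: x k t.
have oy i t : Omega (y i t) by apply: convex_set_sum.
have perturb i t : enorm (x i t.+1 - y i t) <= theta * G * alpha t.
  apply: le_trans (is_proj_dist _ _ _ oc (xproj i t) (oy i t)) _.
  rewrite /y addrAC subrr sub0r enormN enormZ ger0_norm; last first.
    by rewrite ltW ?divr_gt0 ?a0.
  rewrite -/(alpha t) [leRHS]mulrC -mulrA ler_pM2l//.
  by rewrite ler_pM ?invr_ge0 ?enorm_ge0 ?(ltW (phi0 _ _)).
(* The perturbation is everything the round does after mixing: gradient step and projection
   together. *)
have [z zP] := consensus_error A C lambda p x (fun i t => x i t.+1 - y i t)
  (fun t => theta * G * alpha t) BpC (fun i t => esym (subrKC _ _)) perturb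
  (ltW C0) (ltW l0).
set S0 := \sum_i enorm (x i 0%N) in zP.
set D := geometric_filter _ _ _ in zP.
have xx i k t : enorm (x i t - x k t) <= 2 * D t.
  have := enorm_dist (z t) (x i t) (x k t).
  by have := zP i t; have := zP k t; lra.
have yx i t : enorm (y i t - x i t) <= 2 * D t.
  have -> : y i t - x i t = \sum_k Bmx A t i k *: (x k t - x i t).
    under [RHS]eq_bigr do rewrite scalerBr.
    by rewrite sumrB -scaler_suml B1 scale1r.
  apply: le_trans (enorm_sum _ _) _.
  apply: le_trans (_ : _ <= \sum_k Bmx A t i k * (2 * D t)) _.
    by apply: ler_sum => k _; rewrite enormZ ger0_norm// (ler_wpM2l (B0 t i k)).
  by rewrite -mulr_suml B1 mul1r.
(* With this indexing [s t.+1] is the inverse of [alpha t], and [s 0 = 0] as Abel summation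
   requires. *)
pose s (t : nat) : R := Num.sqrt t%:R.
pose W t := \sum_i phi A t i 0 * enorm (x i t - xstar t) ^+ 2.
pose Delta t := enorm (xstar t.+1 - xstar t).
pose L t := \sum_i (f i t (x i t) - f i t (xstar t)).
(* The weights have total mass [n] and two points of [Omega] are at distance at most [2 rad]. *)
have WM t : W t <= 4 * n%:R * rad ^+ 2.
  rewrite -(phi_sum A t A1) mulr_sumr mulr_suml; apply: ler_sum => i _.
  rewrite (mulrC 4) -mulrA ler_pM2l//.
  have -> : 4 * rad ^+ 2 = (2 * rad) ^+ 2 by ring.
  rewrite ler_sqr ?nnegrE ?enorm_ge0 ?mulr_ge0 ?(ltW rad0)//.
  have := enormD (x i t) (- xstar t); rewrite enormN.
  by have := xr i t; have := sr t; lra.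
have shift t : W t.+1 <= \sum_i phi A t.+1 i 0 * enorm (x i t.+1 - xstar t) ^+ 2
    + 4 * n%:R * rad * Delta t.
  rewrite -(phi_sum A t.+1 A1) mulr_sumr !mulr_suml -big_split/=.
  apply: ler_sum => i _; rewrite (mulrC 4) -!mulrA -mulrDr ler_pM2l//.
  by rewrite mulrA sqr_enorm_shift.
(* The one-round inequality divided by [2 alpha t], after replacing the comparator [xstar t] by
   [xstar t.+1] in the second Lyapunov term. *)
have round t : L t <= (s t.+1 * (W t - W t.+1)) / 2
    + 2 * n%:R * rad * (s t.+1 * Delta t)
    + 2 * n%:R * G * D t + n%:R * theta * G ^+ 2 / 2 * alpha t.
  have s0 : 0 < s t.+1 by rewrite sqrtr_gt0.
  have as1 : s t.+1 * alpha t = 1 by rewrite /alpha mulrC divfK ?gt_eqF.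
  have := projected_subgradient_round Omega (f ^~ t) (fun i => phi A t i 0)
    (fun i => phi A t.+1 i 0) (Bmx A t) (x ^~ t) (g ^~ t) (x ^~ t.+1)
    (xstar t) (alpha t) theta G oc (os t) (phi0 ^~ t.+1) (phiV ^~ t.+1) (B0 t)
    (B1 t) (fun k => Bmx_phi A t k A1 (phin0 t.+1)) (gsub ^~ t) (gG' ^~ t)
    (a0 t) (xproj ^~ t).
  rewrite -/(L t) -/(W t).
  have Y : \sum_i enorm (y i t - x i t) <= n%:R * (2 * D t).
    apply: le_trans (ler_sum _ (fun i _ => yx i t)) _.
    by rewrite sumr_const card_ord (mulr_natl _ n).
  have {}Y := ler_wpM2l (ltW G0) Y.
  have {}Y := ler_wpM2l (ltW (a0 t)) Y.
  move: Y; rewrite /y; set Z := \sum_i enorm _ => Y h.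
  have {}h : 2 * alpha t * L t <= W t - W t.+1 + 4 * n%:R * rad * Delta t
      + 2 * (alpha t * (G * (n%:R * (2 * D t))))
      + alpha t ^+ 2 * (n%:R * theta * G ^+ 2).
    by have := shift t; lra.
  have := ler_wpM2l (ltW s0) h.
  have -> : s t.+1 * (2 * alpha t * L t) = 2 * L t * (s t.+1 * alpha t) by ring.
  set rhs := (X in _ <= X -> _).
  have -> : rhs = s t.+1 * (W t - W t.+1) + 4 * n%:R * rad * (s t.+1 * Delta t)
      + 4 * n%:R * G * D t * (s t.+1 * alpha t)
      + alpha t * (n%:R * theta * G ^+ 2) * (s t.+1 * alpha t).
    by rewrite /rhs; ring.
  by rewrite as1; lra.
(* With [d = |x - u|], AM-GM reads [2 d G <= theta^-1 d^2 + theta G^2], and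
   [theta^-1 <= phi <= s T * phi] since [T >= 1]. *)
have last : L T <= s T * W T / 2 + n%:R * theta * G ^+ 2 / 2.
  have s1 : 1 <= s T by rewrite -[1]sqrtr1 ler_sqrt ?ler1n ?ler0n.
  have -> : n%:R * theta * G ^+ 2 / 2 = \sum_(i < n) (theta * G ^+ 2 / 2).
    by rewrite sumr_const card_ord -(mulr_natl _ n); ring.
  rewrite /L /W mulr_sumr mulr_suml -big_split/=; apply: ler_sum => i _.
  have h1 : f i T (x i T) - f i T (xstar T) <= enorm (x i T - xstar T) * G.
    have := gsub i T (xstar T); rewrite -(opprB (x i T)) edotNr.
    have := edot_le (g i T) (x i T - xstar T).
    by have := ler_wpM2r (enorm_ge0 (x i T - xstar T)) (gG' i T); lra.
  set d := enorm (x i T - xstar T) in h1 *.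
  have h2 : theta^-1 * d ^+ 2 <= s T * (phi A T i 0 * d ^+ 2).
    rewrite mulrA ler_wpM2r ?sqr_ge0//; apply: le_trans (phith i T) _.
    by rewrite ler_peMl ?(ltW (phi0 _ _)).
  have : 0 <= theta^-1 * (d - theta * G) ^+ 2.
    by rewrite mulr_ge0 ?sqr_ge0// invr_ge0 ltW.
  have -> : theta^-1 * (d - theta * G) ^+ 2
      = theta^-1 * d ^+ 2 - 2 * (d * G) + theta * G ^+ 2.
    by field; rewrite gt_eqF.
  by lra.
have node t : total_cost f t (x j t) - total_cost f t (xstar t)
    <= L t + 2 * n%:R * G * D t.
  have -> : L t + 2 * n%:R * G * D t
      = \sum_i (f i t (x i t) - f i t (xstar t) + G * (2 * D t)).
    by rewrite big_split/= -/(L t) sumr_const card_ord -(mulr_natl _ n); ring.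
  rewrite -sumrB; apply: ler_sum => i _.
  have := subgradient_bound_lipschitz Omega (f i t) G (x j t) (x i t) (hf i t)
    (gG i t) (ox j t).
  by have := ler_wpM2l (ltW G0) (xx j i t); lra.
have S00 : 0 <= S0 by apply: sumr_ge0 => i _; exact: enorm_ge0.
have b0 t : 0 <= C * n%:R * (theta * G * alpha t).
  by rewrite !mulr_ge0 ?(ltW C0) ?(ltW th0) ?(ltW G0) ?(ltW (a0 t)).
have CS0 : 0 <= C * S0 by rewrite mulr_ge0 ?(ltW C0).
have D0 t : 0 <= D t by apply: geometric_filter_ge0; rewrite ?(ltW l0).
(* Only the [T] rounds before the last take a step, whence the bound at [T.-1]. *)
have sumalpha : \sum_(0 <= t < T) alpha t <= 2 * s T - 1.
  by have := @sum_inv_sqrt R T.-1; rewrite prednK.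
have sS t : s t <= s t.+1 by rewrite ler_sqrt ?ler0n ?ler_nat.
(* Here [t < T] gives [s t.+1 <= s T]; the path variation has one more term, at [t = T], which is
   nonnegative. *)
have sumDelta :
    \sum_(0 <= t < T) s t.+1 * Delta t <= s T * path_variation xstar T.
  apply: le_trans (_ : _ <= s T * \sum_(0 <= t < T) Delta t) _.
    rewrite mulr_sumr big_nat [leRHS]big_nat; apply: ler_sum => t /andP[_ tT].
    by rewrite ler_wpM2r ?enorm_ge0// ler_sqrt ?ler0n ?ler_nat.
  rewrite ler_wpM2l ?sqrtr_ge0// /path_variation big_nat_recr//= lerDl.
  exact: enorm_ge0.
have abel := abel_sum_le s W (4 * n%:R * rad ^+ 2) T (sqrtr0 _) sS WM.
have sumD : \sum_(0 <= t < T) D t <= \sum_(0 <= t < T.+1) D t.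
  by rewrite big_nat_recr//= lerDl.
have sumL : \sum_(0 <= t < T) L t
    <= (\sum_(0 <= t < T) s t.+1 * (W t - W t.+1)) / 2
       + 2 * n%:R * rad * (\sum_(0 <= t < T) s t.+1 * Delta t)
       + 2 * n%:R * G * (\sum_(0 <= t < T) D t)
       + n%:R * theta * G ^+ 2 / 2 * (\sum_(0 <= t < T) alpha t).
  rewrite mulr_suml !mulr_sumr -!big_split/=.
  by apply: ler_sum => t _; exact: round.
rewrite /dynamic_regret -sumrB.
(* The coefficient [4 n G] collects [2 n G] from mixing in [round] and [2 n G] from evaluating at
   node [j] in [node]. The additive constant of [last] cancels against the [- 1] of [sumalpha]. *)
apply: le_trans (_ : _ <= 2 * n%:R * rad ^+ 2 * s T
    + 2 * n%:R * rad * path_variation xstar T * s T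
    + n%:R * theta * G ^+ 2 * s T
    + 4 * n%:R * G * \sum_(0 <= t < T.+1) D t) _.
  apply: le_trans (ler_sum _ (fun t _ => node t)) _.
  rewrite big_split/= -mulr_sumr big_nat_recr//=.
  have k1 : 0 <= 2 * n%:R * rad by rewrite !mulr_ge0 ?(ltW rad0).
  have k2 : 0 <= 2 * n%:R * G by rewrite !mulr_ge0 ?(ltW G0).
  have k3 : 0 <= n%:R * theta * G ^+ 2 / 2.
    by rewrite divr_ge0 ?mulr_ge0 ?(ltW th0) ?(ltW G0).
  have := ler_wpM2l k1 sumDelta; have := ler_wpM2l k2 sumD.
  by have := ler_wpM2l k3 sumalpha; lra.
apply: regret_constants => //.
- apply: le_trans (ler_sum _ (fun i _ => xr i 0%N)) _.
  by rewrite sumr_const card_ord (mulr_natl _ n).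
- exact: sqrtr_ge0.
- apply: le_trans (sum_geometric_filter _ _ _ T (ltW l0) CS0 b0) _.
  rewrite lerD2l -2!mulr_sumr mulrA.
  apply: ler_wpM2l; last by apply: le_trans sumalpha _; rewrite /s; lra.
  by rewrite !mulr_ge0 ?(ltW C0) ?(ltW th0) ?(ltW G0).
Qed.
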